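(* If $p$ and $q$ are positive integers, then the numbers of ssymmetric clans satisfy the recurrence $$c_{p,q}=c_{p-1,q}+c_{p,q-1}+2(p+q-1)\,c_{p-1,q-1},$$ where $c_{p,q}$ denotes the number of ssymmetric $(2p,2q)$ clans.
   Context: For nonnegative integers $p,q$ put $n=p+q$. A $(2p,2q)$ preclan is a string $c_1c_2\cdots c_{2n}$ whose entries are the symbols $+$, $-$ or natural numbers, such that the number of $+$'s minus the number of $-$'s equals $2p-2q$, and every number that appears in the string appears exactly twice. Two $(2p,2q)$ preclans are equivalent if they have the same signs in the same positions and the positions of the matching (equal) numbers are the same in both. A $(2p,2q)$ clan is an equivalence class of $(2p,2q)$ preclans. It is symmetric if a representing preclan $c_1\cdots c_{2n}$ is equivalent to its reversal $c_{2n}\cdots c_1$. A ssymmetric $(2p,2q)$ clan is a symmetric $(2p,2q)$ clan such that $c_i\ne c_{2n+1-i}$ whenever $c_i$ is a number. The number of ssymmetric $(2p,2q)$ clans is denoted $c_{p,q}$; it is considered for all nonnegative $p,q$ (with no order imposed between $p$ and $q$), with $c_{p,q}=1$ whenever $p=0$ or $q=0$. *)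

(* Defs.v *)
From HB Require Import structures.
From mathcomp Require Import all_boot all_order all_algebra.

Set Implicit Arguments.
Unset Strict Implicit.
Unset Printing Implicit Defensive.

Inductive symbol := Plus | Minus | Num of nat.

Definition symbol_code (x : symbol) : bool + nat :=
  match x with Plus => inl true | Minus => inl false | Num k => inr k end.
Definition symbol_decode (u : bool + nat) : symbol :=
  match u with inl true => Plus | inl false => Minus | inr k => Num k end.
Lemma symbol_codeK : cancel symbol_code symbol_decode.
Proof. by case. Qed.
HB.instance Definition _ := Countable.copy symbol (can_type symbol_codeK).

Definition is_num (x : symbol) : bool := if x is Num _ then true else false.

Definition preclan_axiom (p q : nat) (s : seq symbol) : bool :=
  ((count_mem Plus s)%:Z - (count_mem Minus s)%:Z
     == (2 * p)%:Z - (2 * q)%:Z :> int)%R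
  && all (fun x => is_num x ==> (count_mem x s == 2)) s.

Record preclan (p q : nat) := Preclan {
  preclan_string :> (2 * (p + q)).-tuple symbol;
  preclanP : preclan_axiom p q preclan_string }.

HB.instance Definition _ (p q : nat) := [isSub for @preclan_string p q].
HB.instance Definition _ (p q : nat) := [Countable of preclan p q by <:].

(* The second conjunct compares the sets of pairs (i, j) of positions carrying
   equal numbers. *)
Definition preclan_equiv (p q : nat) : rel (preclan p q) := fun c d =>
  [forall i, ((tnth c i == Plus) == (tnth d i == Plus))
             && ((tnth c i == Minus) == (tnth d i == Minus))]
  && [forall i, forall j, (is_num (tnth c i) && (tnth c i == tnth c j))
                       == (is_num (tnth d i) && (tnth d i == tnth d j))].

Lemma preclan_equiv_refl p q : reflexive (@preclan_equiv p q).
Proof.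
by move=> c; apply/andP; split; apply/forallP=> i; rewrite ?eqxx //; apply/forallP.
Qed.

Lemma preclan_equiv_sym p q : symmetric (@preclan_equiv p q).
Proof.
move=> c d; congr (_ && _); apply: eq_forallb => i.
  by rewrite ![(tnth c i == _) == _]eq_sym.
by apply: eq_forallb => j; rewrite eq_sym.
Qed.

Lemma preclan_equiv_trans p q : transitive (@preclan_equiv p q).
Proof.
move=> d c e /andP[/forallP cd1 /forallP cd2] /andP[/forallP de1 /forallP de2].
apply/andP; split; apply/forallP=> i.
  have /andP[/eqP-> /eqP->] := cd1 i.
  by have /andP[/eqP-> /eqP->] := de1 i; rewrite !eqxx.
apply/forallP=> j; have /forallP/(_ j)/eqP-> := cd2 i.
by have /forallP/(_ j) := de2 i.
Qed.

Canonical preclan_equiv_rel p q :=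
  EquivRel (@preclan_equiv p q) (@preclan_equiv_refl p q)
           (@preclan_equiv_sym p q) (@preclan_equiv_trans p q).

Local Open Scope quotient_scope.

Definition clan (p q : nat) := {eq_quot (@preclan_equiv p q)}.

HB.instance Definition _ (p q : nat) := Choice.on (clan p q).
HB.instance Definition _ (p q : nat) := EqQuotient.on (clan p q).
Lemma clan_pickleK p q : @pcancel nat (clan p q) (pickle \o repr)
  (omap \pi_(clan p q) \o (@unpickle (preclan p q))).
Proof. by move=> x /=; rewrite pickleK /= reprK. Qed.
HB.instance Definition _ (p q : nat) :=
  Choice_isCountable.Build (clan p q) (@clan_pickleK p q).

(* Finiteness of [clan p q]: renaming each number to the index of its first
   occurrence gives an equivalent preclan whose numbers are smaller than its
   length. *)
Definition normalize (s : seq symbol) (x : symbol) : symbol :=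
  if is_num x then Num (index x s) else x.

Lemma normalize_inj s : {in s &, injective (normalize s)}.
Proof.
move=> x y xs ys; rewrite /normalize.
case: ifPn => nx; case: ifPn => ny //.
- by case=> /(congr1 (nth x s)); rewrite !nth_index.
- by move=> xy; move: ny; rewrite -xy.
- by move=> xy; move: nx; rewrite xy.
Qed.

Lemma is_num_normalize s x : is_num (normalize s x) = is_num x.
Proof. by case: x. Qed.

Lemma count_normalize s x : x \in s ->
  count_mem (normalize s x) (map (normalize s) s) = count_mem x s.
Proof.
move=> xs; rewrite count_map; apply: eq_in_count => y ys /=.
by apply/eqP/eqP => [/normalize_inj->|->].
Qed.

Lemma normalize_axiom p q (c : preclan p q) :
  preclan_axiom p q (map_tuple (normalize c) c).
Proof.
have /andP[sgnc /allP numc] := preclanP c; apply/andP; split.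
  rewrite !count_map (@eq_count _ _ (pred1 Plus)); last by case.
  by rewrite (@eq_count _ (preim _ (pred1 Minus)) (pred1 Minus)); last by case.
rewrite all_map; apply/allP=> x xc /=; rewrite is_num_normalize.
by rewrite count_normalize //; apply: numc.
Qed.

Definition normalize_preclan p q (c : preclan p q) : preclan p q :=
  Preclan (normalize_axiom c).

Lemma normalize_preclan_equiv p q (c : preclan p q) :
  preclan_equiv (normalize_preclan c) c.
Proof.
apply/andP; split; apply/forallP=> i /=.
  by rewrite !tnth_map; case: (tnth c i).
apply/forallP=> j; rewrite !tnth_map is_num_normalize.
by apply/eqP; congr (_ && _); apply/eqP/eqP=> [/normalize_inj->|->] //;
  apply: mem_tnth.
Qed.

Definition bounded_symbol m (u : bool + 'I_m) : symbol :=
  symbol_decode (match u with inl b => inl b | inr k => inr (k : nat) end).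

Definition clan_enum p q : seq (clan p q) :=
  undup (map \pi_(clan p q) (pmap insub
    (map (map_tuple (@bounded_symbol (2 * (p + q))))
         (enum {: (2 * (p + q)).-tuple (bool + 'I_(2 * (p + q)))})))).

Lemma clan_enumP p q : Finite.axiom (clan_enum p q).
Proof.
apply: Finite.uniq_enumP; first exact: undup_uniq.
move=> x; rewrite mem_undup -[x]reprK; set c := repr x.
apply/mapP; exists (normalize_preclan c); last first.
  by apply/eqmodP; rewrite /= preclan_equiv_sym; apply: normalize_preclan_equiv.
rewrite mem_pmap_sub /=.
have idx_lt (i : 'I_(2 * (p + q))) : index (tnth c i) c < 2 * (p + q).
  by rewrite -[X in _ < X](size_tuple c) index_mem mem_tnth.
pose k i := Ordinal (idx_lt i).
pose t := [tuple match tnth c i with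
           | Plus => inl true | Minus => inl false
           | Num _ => inr (k i) end | i < 2 * (p + q)].
apply/mapP; exists t; first exact: mem_enum.
apply: eq_from_tnth => i; rewrite !tnth_map tnth_ord_tuple /normalize.
by case ci: (tnth c i) => [||a] //=; rewrite /bounded_symbol /= ci.
Qed.

HB.instance Definition _ (p q : nat) := isFinite.Build (clan p q) (@clan_enumP p q).

Lemma preclan_rev_axiom p q (c : preclan p q) :
  preclan_axiom p q [tuple of rev c].
Proof.
have /andP[sgnc numc] := preclanP c; rewrite /preclan_axiom /= !count_rev sgnc /=.
by rewrite all_rev; apply: sub_all numc => x; rewrite count_rev.
Qed.

Definition preclan_rev (p q : nat) (c : preclan p q) : preclan p q :=
  Preclan (preclan_rev_axiom c).

Definition symmetric_preclan (p q : nat) (c : preclan p q) : bool :=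
  preclan_equiv c (preclan_rev c).

Definition ssymmetric_preclan (p q : nat) (c : preclan p q) : bool :=
  symmetric_preclan c
  && [forall i, is_num (tnth c i) ==> (tnth c i != tnth c (rev_ord i))].

(* This does not depend on the representative, see [ssymmetric_pi]. *)
Definition ssymmetric (p q : nat) (x : clan p q) : bool :=
  ssymmetric_preclan (repr x).

Lemma symmetric_preclan_equiv p q (c d : preclan p q) :
  preclan_equiv c d -> symmetric_preclan c = symmetric_preclan d.
Proof.
have rev_equiv (a b : preclan p q) :
    preclan_equiv a b -> preclan_equiv (preclan_rev a) (preclan_rev b).
  move=> /andP[/forallP ab1 /forallP ab2].
  have tnthr (e : preclan p q) i : tnth (preclan_rev e) i = tnth e (rev_ord i).
    rewrite !(tnth_nth Plus) /= nth_rev size_tuple //.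
  apply/andP; split; apply/forallP=> i; first by rewrite !tnthr; apply: ab1.
  by apply/forallP=> j; rewrite !tnthr; have /forallP := ab2 (rev_ord i); apply.
have imp (a b : preclan p q) :
    preclan_equiv a b -> symmetric_preclan a -> symmetric_preclan b.
  move=> ab sa; apply: preclan_equiv_trans (rev_equiv _ _ ab).
  by apply: preclan_equiv_trans sa; rewrite preclan_equiv_sym.
move=> cd; apply/idP/idP; apply: imp => //; by rewrite preclan_equiv_sym.
Qed.

Lemma ssymmetric_preclan_equiv p q (c d : preclan p q) :
  preclan_equiv c d -> ssymmetric_preclan c = ssymmetric_preclan d.
Proof.
move=> cd; rewrite /ssymmetric_preclan (symmetric_preclan_equiv cd); congr (_ && _).
have /andP[_ /forallP cd2] := cd; apply: eq_forallb => i.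
have /forallP/(_ (rev_ord i))/eqP := cd2 i.
have /forallP/(_ i)/eqP := cd2 i; rewrite !eqxx !andbT => ->.
by case: (is_num _) => //= ->.
Qed.

Lemma ssymmetric_pi p q (c : preclan p q) :
  ssymmetric (\pi_(clan p q) c) = ssymmetric_preclan c.
Proof. by apply: ssymmetric_preclan_equiv; apply/eqmodP; rewrite reprK. Qed.

Definition ssymmetric_clan_count (p q : nat) : nat :=
  #|[set x : clan p q | ssymmetric x]|.

(* Main.v *)
Require Import Defs.
From mathcomp Require Import all_boot all_order all_algebra.
From mathcomp Require Import zify.

Set Implicit Arguments.
Unset Strict Implicit.
Unset Printing Implicit Defensive.

Import GRing.Theory.

(** A clan on N positions is the same thing as a map w from the positions to
    signs and positions, sending a signed position to its sign and a numbered
    position to the other position carrying the same number. Let r be the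
    reversal of positions, which has no fixed point as N is even. The clan is
    symmetric when w commutes with r, and ssymmetric when moreover no position
    is matched with its mirror image.

    To count such diagrams, consider them over any finite set A of positions
    stable under a fixed-point-free involution r, and look at the value of w at
    a chosen x in A. If w x is a sign, then w (r x) is the same sign, and erasing
    x and r x leaves a diagram on A minus {x, r x} whose sign balance (number of
    plus signs minus number of minus signs) has changed by 2. If w x = y, then y
    is any of the #|A| - 2 points of A other than x and r x, w also matches r x
    with r y, and erasing these four points leaves the balance unchanged. In each
    case the erasure is bijective, so the count C(n, d) for #|A| = 2n and balance
    d depends on n and d only and satisfies
      C(n, d) = C(n-1, d-2) + C(n-1, d+2) + 2(n-1) C(n-2, d).
    The recurrence for clans is the case n = p + q, d = 2p - 2q: decreasing p
    (resp. q) by one decreases (resp. increases) d by 2, and decreasing both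
    preserves d.

    The bijectivity of erasure is [card_diagrams_extending], the recurrence is
    [diagrams_rec], and the dictionary between clans and diagrams consists of
    [links_equiv], [links_diagram] and [links_surj]. *)

Lemma card_can_in (S S' : finType) (D : {set S}) (D' : {set S'})
    (f : S -> S') (g : S' -> S) :
    {in D, forall x, f x \in D'} -> {in D', forall y, g y \in D} ->
    {in D, cancel f g} -> {in D', cancel g f} ->
  #|D| = #|D'|.
Proof.
move=> fD gD' fK gK; rewrite -(card_in_imset (can_in_inj fK)).
apply: eq_card => y; apply/imsetP/idP => [[x xD ->]|yD']; first exact: fD.
by exists (g y); rewrite ?gK ?gD'.
Qed.

(** * Matching diagrams invariant under an involution *)

Section Diagrams.

Variables (T : finType) (r : T -> T).
Hypotheses (rK : involutive r) (r_neq : forall x, r x != x).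

Implicit Types (A B : {set T}) (d e : int) (x y z : T).
Implicit Types (u w : {ffun T -> bool + T}) (v : bool + T).

Definition mirror v : bool + T :=
  match v with inl b => inl b | inr y => inr (r y) end.

(** Only signs weigh, so that erasing an arc does not change the balance. *)
Definition weight v : int :=
  match v with inl true => 1 | inl false => - 1 | inr _ => 0 end%R.

Definition balance w : int := (\sum_x weight (w x))%R.

(** A diagram on A is a total map, in which a point outside A is matched with
    itself. With this convention a point of A is never its own mate, equivariance
    and symmetry can be required at all points, and the points outside A do not
    contribute to the balance. *)
Definition diagram A w : bool :=
  [forall x, [&& w (r x) == mirror (w x), w x != inr (r x),
                 (w x == inr x) == (x \notin A)
               & if w x is inr y then w y == inr x else true]].

Definition diagrams A d : {set {ffun T -> bool + T}} :=
  [set w | diagram A w && (balance w == d)].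

Lemma diagramP A w :
  reflect [/\ forall x, w (r x) = mirror (w x),
              forall x, w x <> inr (r x),
              forall x, w x = inr x <-> x \notin A
            & forall x y, w x = inr y -> w y = inr x]
          (diagram A w).
Proof.
apply: (iffP forallP) => [wP | [w_r w_nr wA w_sym] x].
  split=> x; have /and4P[/eqP w_r /eqP w_nr /eqP wA w_sym] := wP x => //.
    by rewrite -wA; split=> /eqP.
  by move=> y wx; move: w_sym; rewrite wx => /eqP.
rewrite w_r eqxx andTb; apply/and3P; split; first by apply/eqP; apply: w_nr.
  by apply/eqP; apply/idP/idP => [/eqP/wA | /wA/eqP].
by case wx: (w x) => [//|y]; rewrite (w_sym _ _ wx).
Qed.

Lemma diagram_stable A w x : diagram A w -> (r x \in A) = (x \in A).
Proof.
move=> dw; have [w_r _ wA _] := diagramP _ _ dw.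
have imp z : z \notin A -> r z \notin A by move/wA => wz; apply/wA; rewrite w_r wz.
apply/idP/idP; apply: contraLR; first exact: imp.
by move/imp; rewrite rK.
Qed.

Lemma diagram_mate A w x y :
  diagram A w -> w x = inr y -> (y \in A) = (x \in A).
Proof.
case/diagramP=> _ _ wA w_sym wx; have wy := w_sym _ _ wx.
apply/idP/idP; apply: contraLR => /[dup] zA /wA wz.
  by move: wx; rewrite wz => -[<-].
by move: wy; rewrite wz => -[<-].
Qed.

(** * Gluing and erasing *)

Definition glue B u w : {ffun T -> bool + T} :=
  [ffun z => if z \in B then u z else w z].

Definition blank : {ffun T -> bool + T} := [ffun z => inr z].

(** A diagram on B maps B to itself and is compatible with r, so it never links B
    to the rest of A: diagrams on B and on A minus B do not interact. *)
Lemma diagram_glue A B u w : B \subset A ->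
  diagram B u -> diagram (A :\: B) w -> diagram A (glue B u w).
Proof.
move=> sBA du dw; have [u_r u_nr uB u_sym] := diagramP _ _ du.
have [w_r w_nr wA w_sym] := diagramP _ _ dw.
apply/diagramP; split=> [x|x|x|x y]; rewrite !ffunE.
- by rewrite (diagram_stable _ du); case: ifP.
- by case: ifP.
- case: ifPn => xB; last by have := wA x; rewrite in_setD xB.
  by have := uB x; rewrite xB (subsetP sBA).
- case: ifPn => xB xy.
    by rewrite (diagram_mate du xy) xB; apply: u_sym.
  case: ifPn => yB; last exact: w_sym.
  have [_] := wA y; rewrite in_setD yB => /(_ isT) wy.
  by move: (w_sym _ _ xy); rewrite wy => -[yx]; rewrite -yx yB in xB.
Qed.

Lemma balance_glue A B u w : diagram B u -> diagram (A :\: B) w ->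
  balance (glue B u w) = (balance u + balance w)%R.
Proof.
case/diagramP=> _ _ uB _ /diagramP[_ _ wA _].
rewrite /balance -big_split; apply: eq_bigr => x _; rewrite ffunE.
case: ifPn => xB /=; last by have [_ /(_ xB)->] := uB x; rewrite add0r.
by have [_ ->] := wA x; rewrite ?addr0 // in_setD xB.
Qed.

Lemma diagram_erase A B u w : diagram B u -> diagram A w ->
  {in B, u =1 w} -> diagram (A :\: B) (glue B blank w).
Proof.
move=> du dw uw; have [u_r u_nr uB u_sym] := diagramP _ _ du.
have [w_r w_nr wA w_sym] := diagramP _ _ dw.
apply/diagramP; split=> [x|x|x|x y]; rewrite !ffunE.
- by rewrite (diagram_stable _ du); case: ifP.
- case: ifP => // _ [] /esym/eqP; apply/negP; exact: r_neq.
- by have := wA x; rewrite in_setD; case: ifP.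
- case: ifPn => [xB [<-]|xB xy]; first by rewrite xB.
  case: ifPn => yB; last exact: w_sym.
  have uy : u y = inr x by rewrite uw //; apply: w_sym.
  by rewrite -(diagram_mate du uy) (negbTE xB) in yB.
Qed.

(** Among the diagrams on A that agree with u on B, erasing B loses no information:
    gluing u back on B is the inverse operation. *)
Lemma card_diagrams_extending A B u d : B \subset A -> diagram B u ->
  #|[set w in diagrams A d | [forall x in B, w x == u x]]|
    = #|diagrams (A :\: B) (d - balance u)%R|.
Proof.
move=> sBA du; apply: (@card_can_in _ _ _ _ (glue B blank) (glue B u)).
- move=> w; rewrite !inE => /andP[/andP[dw /eqP bw] /forall_inP uw].
  have dw' : diagram (A :\: B) (glue B blank w).
    by apply: (diagram_erase du dw) => x /uw/eqP->.
  have wE : w = glue B u (glue B blank w).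
    by apply/ffunP=> x; rewrite !ffunE; case xB: (x \in B) => //; apply/eqP/uw.
  by rewrite dw' -bw {2}wE (balance_glue du dw') addrAC subrr add0r eqxx.
- move=> w; rewrite !inE => /andP[dw /eqP bw].
  rewrite (diagram_glue sBA du dw) (balance_glue du dw) bw addrC subrK eqxx /=.
  by apply/forall_inP=> x xB; rewrite ffunE xB.
- move=> w; rewrite inE => /andP[_ /forall_inP uw].
  by apply/ffunP=> x; rewrite !ffunE; case xB: (x \in B) => //; apply/esym/eqP/uw.
- move=> w; rewrite inE => /andP[/diagramP[_ _ wA _] _].
  apply/ffunP=> x; rewrite !ffunE; case xB: (x \in B) => //.
  by have [_ ->] := wA x; rewrite // in_setD xB.
Qed.

(** * The recurrence for diagrams *)

Definition sign_pair x b : {ffun T -> bool + T} :=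
  [ffun z => if z \in [set x; r x] then inl b else inr z].

Lemma sign_pair_diagram x b : diagram [set x; r x] (sign_pair x b).
Proof.
apply/diagramP; split=> [z|z|z|z y]; rewrite !ffunE !inE.
- rewrite (inj_eq (inv_inj rK)) (can2_eq rK rK) orbC; by case: ifP.
- by case: ifP => // _ [] /esym/eqP; apply/negP; exact: r_neq.
- by case: ifP.
- by case: ifP => // zx [<-]; rewrite zx.
Qed.

Lemma balance_sign_pair x b : balance (sign_pair x b) = (weight (inl b) *+ 2)%R.
Proof.
rewrite /balance (bigD1 x) // (bigD1 (r x)) ?r_neq //= big1 => [|z /andP[zx zrx]].
  by rewrite !ffunE !inE !eqxx orbT addr0 -mulr2n.
by rewrite ffunE !inE (negbTE zx) (negbTE zrx).
Qed.

Definition arc_pair x y : {ffun T -> bool + T} :=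
  [ffun z => if z == x then inr y else if z == y then inr x
             else if z == r x then inr (r y) else if z == r y then inr (r x)
             else inr z].

(** As y is neither x nor r x, the points x, r x, y, r y are distinct, so that
    the overlapping tests in [arc_pair] do not conflict. *)
Lemma arc_pair_diagram x y : y \notin [set x; r x] ->
  diagram [set x; r x; y; r y] (arc_pair x y).
Proof.
rewrite !inE negb_or => /andP[/negbTE yx /negbTE yrx].
have eq_rl z t : (r z == t) = (z == r t) by rewrite (can2_eq rK rK).
have [rx ry] := (negbTE (r_neq x), negbTE (r_neq y)).
have xry : (x == r y) = false by rewrite -eq_rl eq_sym.
have [xrx yry] : (x == r x) = false /\ (y == r y) = false by rewrite -!eq_rl.
have xy : (x == y) = false by rewrite eq_sym.
(* All equalities between the four points, in both directions. *)
pose eqs := (eq_rl, rK, eqxx, yx, xy, yrx, xry, rx, ry, xrx, yry).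
apply/diagramP; split=> [z|z|z|z t]; rewrite !ffunE ?inE.
- rewrite !eqs.
  have [->|zx] := eqVneq z x; first by rewrite !eqs.
  have [->|zy] := eqVneq z y; first by rewrite !eqs.
  have [_|zrx] := eqVneq z (r x); first by rewrite /= !eqs.
  by have [_|zry] := eqVneq z (r y); rewrite /= ?eqs.
- have [->|zx] := eqVneq z x; first by case=> /eqP; rewrite !eqs.
  have [->|zy] := eqVneq z y; first by case=> /eqP; rewrite !eqs.
  have [->|zrx] := eqVneq z (r x); first by case=> /eqP; rewrite !eqs.
  have [->|zry] := eqVneq z (r y); first by case=> /eqP; rewrite !eqs.
  by case=> /eqP; rewrite eq_sym (negbTE (r_neq z)).
- have [->|zx] := eqVneq z x; first by split=> // -[] /eqP; rewrite !eqs.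
  have [->|zy] := eqVneq z y; first by rewrite !orbT; split=> // -[] /eqP; rewrite !eqs.
  have [->|zrx] := eqVneq z (r x); first by rewrite !orbT; split=> // -[] /eqP; rewrite !eqs.
  by have [->|zry] := eqVneq z (r y); rewrite ?orbT; split=> // -[] /eqP; rewrite !eqs.
- have [->|zx] := eqVneq z x; first by case=> <-; rewrite !eqs.
  have [->|zy] := eqVneq z y; first by case=> <-; rewrite !eqs.
  have [->|zrx] := eqVneq z (r x); first by case=> <-; rewrite !eqs.
  have [->|zry] := eqVneq z (r y); first by case=> <-; rewrite !eqs.
  by case=> <-; rewrite (negbTE zx) (negbTE zy) (negbTE zrx) (negbTE zry).
Qed.

Lemma balance_arc_pair x y : balance (arc_pair x y) = 0%R.
Proof.
by rewrite /balance big1 // => z _; rewrite ffunE; do 4![case: ifP => // _].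
Qed.

(** By equivariance, the sign at x determines the one at r x. *)
Lemma diagrams_sign A x b d : x \in A -> r x \in A ->
  #|[set w in diagrams A d | w x == inl b]|
    = #|diagrams (A :\: [set x; r x]) (d - weight (inl b) *+ 2)%R|.
Proof.
move=> xA rxA; have sBA : [set x; r x] \subset A by rewrite subUset !sub1set xA.
rewrite -(balance_sign_pair x) -(card_diagrams_extending _ sBA (sign_pair_diagram x b)).
apply: eq_card => w; rewrite !inE -andbA -[RHS]andbA.
have [/diagramP[w_r _ _ _] /=|//] := boolP (diagram A w); congr (_ && _).
apply/eqP/forall_inP => [wx z zB | /(_ x)].
  rewrite ffunE zB; move: zB; rewrite !inE => /orP[]/eqP->; rewrite ?w_r wx //.
by rewrite !ffunE !inE eqxx => /(_ isT)/eqP.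
Qed.

(** By symmetry and equivariance, the mate y of x determines those of y, r x and
    r y. *)
Lemma diagrams_arc A x y d : x \in A -> y \in A :\: [set x; r x] ->
    r x \in A -> r y \in A ->
  #|[set w in diagrams A d | w x == inr y]|
    = #|diagrams (A :\: [set x; r x; y; r y]) d|.
Proof.
rewrite inE => xA /andP[yx yA] rxA ryA.
have sBA : [set x; r x; y; r y] \subset A by rewrite !subUset !sub1set xA rxA yA.
have du := arc_pair_diagram yx.
have <- : (d - balance (arc_pair x y))%R = d by rewrite balance_arc_pair subr0.
rewrite -(card_diagrams_extending _ sBA du).
rewrite balance_arc_pair subr0; apply: eq_card => w; rewrite !inE -andbA -[RHS]andbA.
have [/diagramP[w_r _ _ w_sym] /=|//] := boolP (diagram A w); congr (_ && _).
have [u_r _ _ u_sym] := diagramP _ _ du.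
have ux : arc_pair x y x = inr y by rewrite ffunE eqxx.
have uy := u_sym _ _ ux.
apply/eqP/forall_inP => [wx z | /(_ x)]; last by rewrite !inE eqxx ux => /(_ isT)/eqP.
have wy := w_sym _ _ wx.
by rewrite !inE -!orbA => /or4P[] /eqP->; rewrite ?w_r ?u_r ?ux ?uy ?wx ?wy.
Qed.

(** The diagrams on A are sorted by their value at x; values in A minus {x, r x}
    and signs are the only ones that occur. *)
Lemma diagrams_rec A x d : (forall z, (r z \in A) = (z \in A)) -> x \in A ->
  #|diagrams A d| =
    #|diagrams (A :\: [set x; r x]) (d - 2)%R|
    + #|diagrams (A :\: [set x; r x]) (d + 2)%R|
    + \sum_(y in A :\: [set x; r x]) #|diagrams (A :\: [set x; r x; y; r y]) d|.
Proof.
move=> rA xA; rewrite -sum1_card.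
rewrite (partition_big (fun w : {ffun T -> bool + T} => w x) predT) //=.
pose D v := [set w in diagrams A d | w x == v].
have DE v : \sum_(w in diagrams A d | w x == v) 1 = #|D v|.
  by rewrite -sum1_card; apply: eq_bigl => w; rewrite [in RHS]inE.
under eq_bigr do rewrite DE.
rewrite big_sumType; congr (_ + _) => /=.
  by rewrite big_bool /D !diagrams_sign ?rA //= -mulNrn opprK.
rewrite [RHS]big_mkcond; apply: eq_bigr => y _; case: ifPn => yB.
  rewrite /D diagrams_arc ?rA //; by move: yB; rewrite inE => /andP[].
apply/eqP; rewrite cards_eq0; apply/eqP/setP => w; rewrite !inE.
apply: contraNF yB => /andP[/andP[dw _] /eqP wx].
rewrite !inE (diagram_mate dw wx) xA andbT negb_or.
have [_ w_nr wA _] := diagramP _ _ dw; apply/andP; split; apply/eqP => yx.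
  by move: wx; rewrite yx => /(proj1 (wA x)); rewrite xA.
by apply: (w_nr x); rewrite wx yx.
Qed.

End Diagrams.

(** With a single pair of points there is no arc, whence the separate treatment
    of n = 1. *)
Fixpoint diagram_count (n : nat) (d : int) : nat :=
  if n is n'.+1 then
    diagram_count n' (d - 2)%R + diagram_count n' (d + 2)%R
    + (if n' is n''.+1 then 2 * n' * diagram_count n'' d else 0)
  else d == 0%R.

Lemma diagram_countSS n d :
  diagram_count n.+2 d = diagram_count n.+1 (d - 2)%R + diagram_count n.+1 (d + 2)%R
                         + 2 * n.+1 * diagram_count n d.
Proof. by []. Qed.

Section Count.

Variables (T : finType) (r : T -> T).
Hypotheses (rK : involutive r) (r_neq : forall x, r x != x).

Lemma diagrams0 (d : int) : #|diagrams r set0 d| = (d == 0%R).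
Proof.
have -> : diagrams r set0 d = [set w in [set blank T] | d == 0%R].
  apply/setP=> w; rewrite !inE; have [->|w_neq] := eqVneq w (blank T); last first.
    apply/negbTE; apply: contraNN w_neq => /andP[/diagramP[_ _ w0 _] _].
    by apply/eqP/ffunP=> x; rewrite ffunE; apply/w0; rewrite inE.
  rewrite /balance big1 => [|x _]; last by rewrite ffunE.
  rewrite eq_sym; case: eqP => //= _; rewrite ?andbF // andbT.
  apply/diagramP; split=> [x|x|x|x y]; rewrite !ffunE ?inE //.
  by case=> /esym/eqP; apply/negP; apply: r_neq.
case: eqP => _; [rewrite -[RHS](cards1 (blank T))
               | rewrite -[RHS](@cards0 {ffun T -> bool + T})];
  by apply: eq_card => w; rewrite !inE ?andbT ?andbF.
Qed.

(** The index n counts the orbits of r in A. The factor 2 * (n - 1) of the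
    recurrence is the number of possible mates of a point. *)
Lemma card_diagrams n (A : {set T}) d :
  (forall z, (r z \in A) = (z \in A)) -> #|A| = n.*2 ->
  #|diagrams r A d| = diagram_count n d.
Proof.
elim/ltn_ind: n A d => -[|n] IHn A d rA cardA.
  by rewrite (cards0_eq cardA) diagrams0.
have [x xA] : exists x, x \in A by apply/card_gt0P; rewrite cardA.
have stable_del (C : {set T}) y : (forall z, (r z \in C) = (z \in C)) ->
    forall z, (r z \in C :\: [set y; r y]) = (z \in C :\: [set y; r y]).
  by move=> rC z; rewrite !inE rC (inj_eq (inv_inj rK)) (can2_eq rK rK) orbC.
have card_del (C : {set T}) y : (forall z, (r z \in C) = (z \in C)) -> y \in C ->
    #|C :\: [set y; r y]| = #|C| - 2.
  move=> rC yC; rewrite cardsD (setIidPr _) ?subUset ?sub1set ?rC ?yC //.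
  by rewrite cards2 eq_sym r_neq.
set A' := A :\: [set x; r x].
have rA' := stable_del A x rA; have cardA' : #|A'| = n.*2.
  by rewrite card_del // cardA doubleS subn2.
rewrite (diagrams_rec rK r_neq _ rA xA) -/A' !(IHn n) //=; congr (_ + _).
case: n IHn cardA' => [|n] IHn cardA' in cardA *.
  by rewrite (cards0_eq cardA') big_set0.
have eqC y : y \in A' -> #|diagrams r (A :\: [set x; r x; y; r y]) d|
    = diagram_count n d.
  move=> yA'; rewrite -setUA -setDDl.
  by apply: IHn => //; [apply: stable_del | rewrite card_del // cardA' doubleS subn2].
by rewrite (eq_bigr _ eqC) sum_nat_const cardA' mul2n.
Qed.

End Count.

(** * Clans as diagrams *)

Lemma count_tnth (S : Type) n (t : n.-tuple S) (a : pred S) :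
  count a t = #|[set i | a (tnth t i)]|.
Proof.
by rewrite -sum1_count big_tuple -sum1_card; apply: eq_bigl => i; rewrite inE.
Qed.

Lemma rev_ord_neq n (i : 'I_n) : ~~ odd n -> rev_ord i != i.
Proof.
apply: contraNneq => /(congr1 val) /= ri.
by rewrite -(subnK (ltn_ord i)) ri addnS addnn /= odd_double.
Qed.

Lemma count_tnth_int (S : Type) n (t : n.-tuple S) (a : pred S) :
  ((count a t)%:Z = \sum_i (a (tnth t i))%:Z)%R.
Proof.
rewrite count_tnth -sum1_card big_mkcond /=.
rewrite (big_morph Posz PoszD (erefl (Posz 0))).
by apply: eq_bigr => i _; rewrite inE; case: (a _).
Qed.

Section Links.

Variables p q : nat.
Implicit Types (c e : preclan p q) (i j : 'I_(2 * (p + q))).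

(** The default value i in the last case is never taken, by [num_mate]. *)
Definition links c : {ffun 'I_(2 * (p + q)) -> bool + 'I_(2 * (p + q))} :=
  [ffun i => match tnth c i with
             | Plus => inl true
             | Minus => inl false
             | Defs.Num _ => inr (odflt i [pick j | (j != i) && (tnth c j == tnth c i)])
             end].

(** A number occurs exactly twice, so one occurrence remains besides position i. *)
Lemma num_mate c i : is_num (tnth c i) ->
  exists j, forall k, (k != i) && (tnth c k == tnth c i) = (k == j).
Proof.
move=> ni; have /andP[_ /allP/(_ _ (mem_tnth i c))] := preclanP c.
rewrite ni count_tnth (cardsD1 i) inE /= eqxx => /eqP[/eqP/cards1P[j defj]].
by exists j => k; have := in_set1 k j; rewrite -defj !inE.
Qed.

Lemma links_inr c i j :
  (links c i == inr j) = [&& is_num (tnth c i), j != i & tnth c i == tnth c j].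
Proof.
have [ni|] := boolP (is_num (tnth c i)); last by rewrite ffunE; case: (tnth c i).
have [k defk] := num_mate ni.
have -> : links c i = inr k.
  rewrite ffunE; move: ni; case ci: (tnth c i) => [||a] // _; congr inr.
  case: pickP => [l|/(_ k)]; first by rewrite -ci defk => /eqP.
  by rewrite -ci defk eqxx.
by rewrite /= [tnth c i == _]eq_sym defk; apply/eqP/eqP => [[->]|->].
Qed.

Lemma links_inl c i b :
  (links c i == inl b) = (tnth c i == if b then Plus else Minus).
Proof. by rewrite ffunE; case: (tnth c i) b => [||a] []. Qed.

(** The diagram of a preclan records its signs and which positions carry equal
    numbers, and forgets the names of the numbers: this is the data compared by
    [preclan_equiv]. *)
Lemma links_equiv c e : preclan_equiv c e = (links c == links e).
Proof.
apply/andP/eqP => [[/forallP signs /forallP mates]|eq_links].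
  apply/ffunP=> i; case li: (links e i) => [b|j]; apply/eqP.
    move/eqP: li; rewrite !links_inl; have /andP[] := signs i.
    by case: b => /eqP H1 /eqP H2; rewrite ?H1 ?H2.
  move/eqP: li; rewrite !links_inr; have /forallP/(_ j)/eqP := mates i.
  by rewrite !(andbCA _ (j != i)) => ->.
have num_links (a : preclan p q) i :
    is_num (tnth a i) = (if links a i is inr _ then true else false).
  by rewrite ffunE; case: (tnth a i).
split; apply/forallP=> i.
  by rewrite -(links_inl c i true) -(links_inl c i false) eq_links !links_inl !eqxx.
apply/forallP=> j; have [->|ij] := eqVneq i j.
  by rewrite !eqxx !andbT !num_links eq_links.
by have := links_inr c i j; rewrite eq_links links_inr eq_sym ij => /= ->.
Qed.

Lemma tnth_preclan_rev c i : tnth (preclan_rev c) i = tnth c (rev_ord i).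
Proof. by rewrite !(tnth_nth Plus) /= nth_rev size_tuple. Qed.

Lemma links_rev c i :
  links (preclan_rev c) i = mirror (@rev_ord _) (links c (rev_ord i)).
Proof.
case li: (links c (rev_ord i)) => [b|j]; apply/eqP => /=; move/eqP: li.
  by rewrite !links_inl tnth_preclan_rev.
by rewrite !links_inr !tnth_preclan_rev rev_ordK (can2_eq rev_ordK rev_ordK).
Qed.

Lemma balance_links c : balance (links c) = ((2 * p)%:Z - (2 * q)%:Z)%R.
Proof.
have /andP[/eqP <- _] := preclanP c.
rewrite !count_tnth_int -sumrB.
by apply: eq_bigr => i _; rewrite ffunE; case: (tnth c i).
Qed.

(** The symmetry of the clan says that its diagram equals that of the reversed
    string, which by [links_rev] is equivariance; the condition defining
    ssymmetric clans among symmetric ones is that no mate is a mirror image. *)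
Lemma links_diagram c : ssymmetric_preclan c = diagram (@rev_ord _) setT (links c).
Proof.
rewrite /ssymmetric_preclan /symmetric_preclan links_equiv.
apply/andP/diagramP => [[/eqP sym /forallP nrev]|[sym nrev _ _]].
  split=> [i|i|i|i j].
  - by rewrite {1}sym links_rev rev_ordK.
  - move/eqP; rewrite links_inr => /and3P[ni _].
    by have := nrev i; rewrite ni /= => /negbTE->.
  - by rewrite inE; split=> // /eqP; rewrite links_inr eqxx andbF.
  - move/eqP; rewrite links_inr => /and3P[ni ji /eqP cij].
    by apply/eqP; rewrite links_inr -cij ni eqxx eq_sym ji.
split; first by apply/eqP/ffunP=> i; rewrite links_rev -sym rev_ordK.
apply/forallP=> i; apply/implyP=> ni; have := nrev i; apply: contra_notN => cii.
apply/eqP; by rewrite links_inr ni cii rev_ord_neq ?oddM.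
Qed.

(** A string is recovered from a diagram by naming each arc after its left
    endpoint. *)
Lemma links_surj w :
    w \in diagrams (@rev_ord _) setT ((2 * p)%:Z - (2 * q)%:Z)%R ->
  exists c, links c = w.
Proof.
rewrite inE => /andP[/diagramP[_ _ w_in w_sym] /eqP bal_w].
pose t := [tuple match w i with
                 | inl b => if b then Plus else Minus
                 | inr j => Defs.Num (minn i j)
                 end | i < 2 * (p + q)].
have t_inl i b : w i = inl b -> tnth t i = if b then Plus else Minus.
  by move=> wi; rewrite tnth_mktuple wi.
have t_inr i j : w i = inr j -> tnth t i = Defs.Num (minn i j).
  by move=> wi; rewrite tnth_mktuple wi.
have w_neq i j : w i = inr j -> j != i.
  by move=> wi; apply/eqP=> ji; move: wi; rewrite ji => /(proj1 (w_in i)); rewrite inE.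
have t_eq i j : w i = inr j -> forall k, (tnth t k == tnth t i) = (k \in [set i; j]).
  move=> wi k; have wj := w_sym _ _ wi.
  rewrite !inE; apply/eqP/orP => [|[]/eqP->//]; last first.
    by rewrite (t_inr _ _ wi) (t_inr _ _ wj) minnC.
  rewrite (t_inr _ _ wi); case wk: (w k) => [[]|l]; rewrite ?(t_inl _ _ wk) ?(t_inr _ _ wk) //.
  have wl := w_sym _ _ wk; case=> min_kl.
  (* The left endpoints of both arcs agree, so the arcs share a point. *)
  have : [|| k == i, k == j, l == i | l == j].
    by move: min_kl; rewrite -!val_eqE /=; case: ltngtP; case: ltngtP; lia.
  case/or4P=> /eqP E; rewrite ?E ?eqxx; [by left | by right | right | left].
    by move: wl; rewrite E wi => -[->].
  by move: wl; rewrite E wj => -[->].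
have t_axiom : preclan_axiom p q t.
  apply/andP; split.
    rewrite -bal_w !count_tnth_int -sumrB; apply/eqP/eq_bigr => i _.
    case wi: (w i) => [b|j]; last by rewrite (t_inr _ _ wi).
    by rewrite (t_inl _ _ wi); case: b {wi}.
  apply/allP=> x /tnthP[i ->].
  case wi: (w i) => [b|j]; first by rewrite (t_inl _ _ wi); case: b {wi}.
  have cij : #|[set i; j]| = 2 by rewrite cards2 eq_sym (w_neq _ _ wi).
  apply/implyP=> _; rewrite count_tnth; apply/eqP; rewrite -[RHS]cij.
  by apply: eq_card => k; rewrite inE /= (t_eq _ _ wi).
exists (Preclan t_axiom); apply/ffunP=> i; case wi: (w i) => [b|j]; apply/eqP.
  by rewrite links_inl /= (t_inl _ _ wi).
rewrite links_inr /= (w_neq _ _ wi) [tnth t i == _]eq_sym (t_eq _ _ wi) !inE eqxx orbT.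
by rewrite (t_inr _ _ wi).
Qed.

Lemma ssymmetric_clan_count_diagrams :
  ssymmetric_clan_count p q = diagram_count (p + q) ((2 * p)%:Z - (2 * q)%:Z)%R.
Proof.
have even_n : ~~ odd (2 * (p + q)) by rewrite oddM.
rewrite -(card_diagrams rev_ordK (fun i => rev_ord_neq i even_n) (A := setT));
  [|by move=> i; rewrite !inE|by rewrite cardsT card_ord mul2n].
pose f (x : clan p q) := links (repr x).
have f_inj : injective f.
  move=> x y /eqP; rewrite -links_equiv => xy.
  by rewrite -[x]reprK -[y]reprK; apply/eqmodP.
rewrite /ssymmetric_clan_count -(card_imset _ f_inj); apply: eq_card => w.
apply/imsetP/idP => [[x]|/[dup] w_diag /links_surj[c cw]].
  by rewrite inE /ssymmetric links_diagram => sx ->; rewrite inE sx balance_links eqxx.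
have fc : f (\pi_(clan p q) c)%qT = w.
  by apply/eqP; rewrite -cw -links_equiv; apply/eqmodP; rewrite reprK.
exists (\pi_(clan p q) c)%qT => //; rewrite inE ssymmetric_pi links_diagram cw.
by move: w_diag; rewrite inE => /andP[].
Qed.

End Links.

Theorem proposition1p13 (p q : nat) (hp : 0 < p) (hq : 0 < q) :
  ssymmetric_clan_count p q =
    ssymmetric_clan_count (p - 1) q + ssymmetric_clan_count p (q - 1)
    + 2 * (p + q - 1) * ssymmetric_clan_count (p - 1) (q - 1).
Proof.
case: p q hp hq => [//|p] [//|q] _ _; rewrite !ssymmetric_clan_count_diagrams.
rewrite !subn1 !addSn !addnS diagram_countSS !succnK.
by congr (diagram_count _ _ + diagram_count _ _ + 2 * _ * diagram_count _ _); lia.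
Qed.
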